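(* Let $u$ be any unit vector in $\mathbb{R}^2$, and let $\mathcal{M}$ and $\mathcal{V}_{\mathcal{M}}$ be as defined in the context. Then the chromatic number of $\mathcal{V}_{\mathcal{M}}$ is $\chi(\mathcal{V}_{\mathcal{M}})=4$.
   Context: For $\theta\in\mathbb{R}$ and $v\in\mathbb{R}^2$, $r_\theta(v)$ denotes the counterclockwise rotation of $v$ by $\theta$ radians. For a set $\mathcal{U}$ of unit vectors in $\mathbb{R}^2$, let $\operatorname{span}\mathcal{U}=\{a_1u_1+\cdots+a_nu_n : n\in\mathbb{N},\ a_i\in\mathbb{Z},\ u_i\in\mathcal{U}\}$. The vector graph $\mathcal{V}_{\mathcal{U}}$ has vertex set $\operatorname{span}\mathcal{U}\subseteq\mathbb{R}^2$, with $x\sim y$ if and only if $x-y\in\mathcal{U}$ or $y-x\in\mathcal{U}$. Set $\alpha=\arccos\!\left(\frac{1}{2\sqrt3}\right)-\frac{\pi}{6}$ and $\beta=\alpha+\frac{\pi}{3}$, and for a unit vector $u$ define $\mathcal{M}=\{u,\ r_\alpha(u),\ r_{-\alpha}(u),\ r_\beta(u),\ r_{-\beta}(u),\ r_\alpha(u)-r_\beta(u),\ r_{-\alpha}(u)-r_{-\beta}(u)\}$. The chromatic number $\chi(G)$ of a graph $G$ is the least positive integer $k$ such that there is a map $f:V(G)\to\{1,\ldots,k\}$ with $f(x)\neq f(y)$ whenever $x$ and $y$ are adjacent. *)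

(* Defs.v *)
From HB Require Import structures.
From mathcomp Require Import all_boot all_order all_algebra.
From mathcomp Require Import boolp classical_sets reals trigo.

Set Implicit Arguments.
Unset Strict Implicit.
Unset Printing Implicit Defensive.
Import Order.TTheory GRing.Theory Num.Theory.
Local Open Scope classical_set_scope.
Local Open Scope ring_scope.

Record graph := Graph {
  vertex : Type;
  adj : vertex -> vertex -> Prop
}.

Definition proper_coloring (G : graph) (k : nat) (f : vertex G -> 'I_k) : Prop :=
  forall x y : vertex G, adj x y -> f x <> f y.

Definition colorable (G : graph) (k : nat) : Prop :=
  exists f : vertex G -> 'I_k, proper_coloring f.

(* A relation rather than a function to nat, since an infinite graph need not
   have a finite chromatic number. *)
Definition has_chromatic_number (G : graph) (k : nat) : Prop :=
  [/\ (0 < k)%N, colorable G k &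
      forall j : nat, (0 < j)%N -> colorable G j -> (k <= j)%N].

Section Plane.
Variable R : realType.

Local Notation plane := 'cV[R]_2.

(* The library norm on matrices is the sup norm, hence this one. *)
Definition euclidean_norm (v : plane) : R := Num.sqrt (\sum_i v i 0 ^+ 2).

Definition unit_vector (v : plane) : Prop := euclidean_norm v = 1.

(* The rows are (cos t, - sin t) and (sin t, cos t): acting on column vectors,
   this is the counterclockwise rotation. *)
Definition rotation_mx (t : R) : 'M[R]_2 :=
  \matrix_(i < 2, j < 2)
    if i == j then cos t
    else if (i < j)%N then - sin t else sin t.

Definition rotate (t : R) (v : plane) : plane := rotation_mx t *m v.

Definition int_span (U : set plane) : set plane :=
  [set x | exists (n : nat) (a : 'I_n -> int) (u : 'I_n -> plane),
      (forall i, U (u i)) /\ x = \sum_(i < n) u i *~ a i].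

(* Meant for sets U of unit vectors, for which the graph has no loops. *)
Definition vector_graph (U : set plane) : graph :=
  @Graph {x : plane | int_span U x}
    (fun x y => U (sval x - sval y) \/ U (sval y - sval x)).

Definition alpha : R := acos (1 / (2 * Num.sqrt 3)) - pi / 6.

Definition beta : R := alpha + pi / 3.

Definition M_set (u : plane) : set plane :=
  [set u;
       rotate alpha u; rotate (- alpha) u;
       rotate beta u; rotate (- beta) u;
       rotate alpha u - rotate beta u;
       rotate (- alpha) u - rotate (- beta) u].

End Plane.

(* Main.v *)
Require Import Defs.
From mathcomp Require Import all_boot all_order all_algebra.
From mathcomp Require Import reals.
From HB Require Import structures.
From mathcomp Require Import boolp classical_sets trigo zify ring lra.

(** Write a, b, a', b' for the rotations of u by alpha, beta, -alpha, -beta.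
    Then u = a + b + a' + b', and the span contains a Moser spindle, so three
    colors do not suffice. As sqrt 33 is irrational, a, b, a', b' are a basis of the
    span over the integers, and a homomorphism from the span to (Z/2)^2 that
    kills no element of M is a proper 4-coloring. *)

Set Implicit Arguments.
Unset Strict Implicit.
Unset Printing Implicit Defensive.
Import Order.TTheory GRing.Theory Num.Theory.
Local Open Scope ring_scope.

(** * The Moser spindle and the irrationality of sqrt 33 *)

(** With three colors, each of the rhombi o, a, s, b and w, c, s, d gives its two tips the same
    color, so o and w both share the color of s, against the edge from w to o. *)
Lemma spindle_not_3colorable (G : graph) (k : nat) (o a b s c d w : vertex G) :
  adj o a -> adj o b -> adj a b -> adj s a -> adj s b ->
  adj w c -> adj w d -> adj d c -> adj c s -> adj d s -> adj w o ->
  colorable G k -> (4 <= k)%N.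
Proof.
move=> oa ob ab sa sb wc wd dc cs ds wo [f fP].
have neq x y : adj x y -> (f x <> f y :> nat) by move=> /fP xy /val_inj.
move: (neq _ _ oa) (neq _ _ ob) (neq _ _ ab) (neq _ _ sa) (neq _ _ sb).
move: (neq _ _ wc) (neq _ _ wd) (neq _ _ dc) (neq _ _ cs) (neq _ _ ds).
move: (neq _ _ wo) (ltn_ord (f o)) (ltn_ord (f a)) (ltn_ord (f b)).
move: (ltn_ord (f s)) (ltn_ord (f c)) (ltn_ord (f d)) (ltn_ord (f w)).
lia.
Qed.

Lemma sqr_eq33M (p q : int) : p ^+ 2 = 33 * q ^+ 2 -> q = 0.
Proof.
move=> pq; apply: contra_eq pq => q0; apply/eqP => pq.
(* The exponent of 3 is even on the left and odd on the right. *)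
have := congr1 (logn 3 \o absz) pq; rewrite /= abszM !abszX.
rewrite lognM ?expn_gt0 ?absz_gt0 ?q0 //.
rewrite !lognX (_ : logn 3 `|33%Z| = 1%N) //.
lia.
Qed.

Section Plane.
Variable R : realType.
Implicit Types (u v w : 'cV[R]_2) (U : set 'cV[R]_2).

Lemma sqrt33_lin_indep (t : R) (p q : int) :
  t ^+ 2 = 33 -> p%:~R + q%:~R * t = 0 -> p = 0 /\ q = 0.
Proof.
move=> t2 /eqP; rewrite addr_eq0 => /eqP pq.
have q0 : q = 0.
  apply: (@sqr_eq33M p); apply: (@intr_inj R).
  by rewrite rmorphXn /= pq intrM rmorphXn /= sqrrN exprMn t2 mulrC.
by split=> //; apply: (@intr_inj R); rewrite pq q0 mul0r oppr0.
Qed.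

(** * Exact trigonometry of the angles alpha and beta *)

Lemma sin_pi6 : sin (pi / 6) = 1 / 2 :> R.
Proof.
have pi_gt0 := pi_gt0 R.
have s0 : 0 < sin (pi / 6 : R) by apply: sin_gt0_pihalf; lra.
(* Since cos (pi / 3) = sin (pi / 6), the double-angle formula is a quadratic equation in sin (pi /
   6), with roots 1 / 2 and -1. *)
have := cos_mulr2n (pi / 6 : R); rewrite cos2sin2.
rewrite (_ : pi / 6 *+ 2 = pi / 2 - pi / 6); last by field.
rewrite cosB cos_pihalf sin_pihalf mul0r add0r mul1r => e.
have /eqP : (sin (pi / 6 : R) - 1 / 2) * (sin (pi / 6 : R) + 1) = 0.
  by move: e; rewrite mulr2n => e; lra.
by rewrite mulf_eq0 => /orP[] /eqP; lra.
Qed.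

Lemma cos_pi6 : cos (pi / 6) = Num.sqrt 3 / 2 :> R.
Proof.
have pi_gt0 := pi_gt0 R.
have c0 : 0 <= cos (pi / 6 : R) by apply: cos_ge0_pihalf; lra.
rewrite -(ger0_norm c0) -sqrtr_sqr cos2sin2 sin_pi6.
rewrite (_ : 1 - _ = 3 * (1 / 2) ^+ 2); last by field.
by rewrite sqrtrM // sqrtr_sqr ger0_norm; lra.
Qed.

(* Here t = sqrt 33 is 6 sin (acos (1 / (2 sqrt 3))). *)
Lemma cos_sin_alpha_beta : exists t : R,
  [/\ t ^+ 2 = 33, cos (alpha R) = (3 + t) / 12, cos (beta R) = (3 - t) / 12,
      sin (alpha R) = Num.sqrt 3 * (t - 1) / 12
    & sin (beta R) = Num.sqrt 3 * (t + 1) / 12].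
Proof.
pose s : R := Num.sqrt 3; pose g : R := 1 / (2 * s).
have s2 : s ^+ 2 = 3 by rewrite sqr_sqrtr.
have s0 : 0 < s by rewrite sqrtr_gt0.
have gE : g = s / 6.
  apply: (mulIf (lt0r_neq0 s0)); rewrite [RHS]mulrAC -[s * s]expr2 s2 /g.
  by field; exact: lt0r_neq0.
have s3 : s <= 3 by nra.
have g1 : -1 <= g <= 1 by rewrite gE; lra.
have cg : cos (acos g) = g by rewrite acosK.
have g2 : sin (acos g) ^+ 2 = 11 / 12.
  by rewrite sin2cos2 cg gE exprMn s2; field.
(* The angles alpha and beta lie symmetrically about [acos g], at distance pi / 6. *)
have betaE : beta R = acos g + pi / 6 by rewrite /beta /alpha -/s -/g; field.
exists (6 * sin (acos g)); rewrite betaE /alpha -/s -/g.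
rewrite cosB sinB cosD sinD cg sin_pi6 cos_pi6 -/s.
move: (sin _) g2 => h h2; rewrite gE.
have ss : s / 6 * (s / 2) = 1 / 4 by rewrite mulrACA -expr2 s2; field.
by split; rewrite ?ss ?exprMn ?h2; field.
Qed.

Lemma rotateE t u : rotate t u =
  \col_i if i == 0 then cos t * u 0 0 - sin t * u 1 0
         else sin t * u 0 0 + cos t * u 1 0.
Proof.
apply/matrixP => i j; rewrite ord1 !mxE big_ord_recl big_ord1 !mxE /=.
rewrite (_ : lift ord0 ord0 = 1); last exact: val_inj.
by case: i => [[|[|//]] ilt]; rewrite /= ?mulNr.
Qed.

Lemma plane_eq u v : u 0 0 = v 0 0 -> u 1 0 = v 1 0 -> u = v.
Proof.
move=> uv0 uv1; apply/matrixP => i j; rewrite ord1.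
by case: i => [[|[|//]] ilt];
  [rewrite (_ : Ordinal ilt = 0) | rewrite (_ : Ordinal ilt = 1)] => //;
  exact: val_inj.
Qed.

(** The sines cancel in pairs, and cos alpha + cos beta = 1 / 2. *)
Lemma rotate_relation u :
  rotate (alpha R) u + rotate (beta R) u
  + rotate (- alpha R) u + rotate (- beta R) u = u.
Proof.
have [t [_ ca cb _ _]] := cos_sin_alpha_beta.
by rewrite !rotateE !cosN !sinN ca cb; apply: plane_eq; rewrite !mxE /=; field.
Qed.

(** * Integer coordinates on the span and the homomorphism to (Z/2)^2 *)

Definition lattice_vec u (n : int * int * int * int) : 'cV[R]_2 :=
  rotate (alpha R) u *~ n.1.1.1 + rotate (beta R) u *~ n.1.1.2
  + rotate (- alpha R) u *~ n.1.2 + rotate (- beta R) u *~ n.2.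

Fact lattice_vec_is_zmod_morphism u : zmod_morphism (lattice_vec u).
Proof.
move=> m n; rewrite /lattice_vec !mulrzBr !opprD.
by rewrite (AC ((((1*1)*(1*1))*(1*1))*(1*1)) ((1*3*5*7)*(2*4*6*8))).
Qed.

HB.instance Definition _ u := GRing.isZmodMorphism.Build _ _ (lattice_vec u)
  (lattice_vec_is_zmod_morphism u).

(** In complex terms, an integer combination of the four rotations is multiplication by (X + i s Y)
    / 12 with s = sqrt 3. If it kills u, then X and Y vanish, and the independence of 1 and sqrt 33
    over the integers gives four linear equations with only the zero solution. *)
Lemma lattice_vec_inj u : unit_vector u -> injective (lattice_vec u).
Proof.
move=> hu; apply: raddf_inj => -[[[n1 n2] n3] n4].
have hu2 : u 0 0 ^+ 2 + u 1 0 ^+ 2 = 1.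
  have : 0 <= \sum_i u i 0 ^+ 2 by apply: sumr_ge0 => i _; exact: sqr_ge0.
  move=> /sqr_sqrtr; rewrite -/(euclidean_norm u) hu big_ord_recl big_ord1.
  by rewrite (_ : lift ord0 ord0 = 1) ?expr1n //; exact: val_inj.
have [t [t2 ca cb sa sb]] := cos_sin_alpha_beta.
rewrite /= /lattice_vec /= -!scaler_int !rotateE !cosN !sinN ca cb sa sb => e.
have := congr1 (fun v : 'cV_2 => v 0 0) e.
have := congr1 (fun v : 'cV_2 => v 1 0) e.
rewrite !mxE /=.
move: hu2; set x := u 0 0; set y := u 1 0; set s := Num.sqrt 3.
have s0 : s != 0 by rewrite sqrtr_eq0 -ltNge.
move=> xy ey ex.
pose N1 : R := n1%:~R; pose N2 : R := n2%:~R.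
pose N3 : R := n3%:~R; pose N4 : R := n4%:~R.
rewrite -/N1 -/N2 -/N3 -/N4 in ex ey.
pose X := 3 * (N1 + N2 + N3 + N4) + (N1 - N2 + N3 - N4) * t.
pose Y := (N2 - N1 + N3 - N4) + (N1 + N2 - N3 - N4) * t.
have ex' : X * x - s * Y * y = 0 by rewrite /X /Y; lra.
have ey' : s * Y * x + X * y = 0 by rewrite /X /Y; lra.
have X0 : X = 0.
  (* Multiplying by the conjugate of the unit x + i y isolates X, and below s Y. *)
  have -> : X = x * (X * x - s * Y * y) + y * (s * Y * x + X * y)
                + X * (1 - (x ^+ 2 + y ^+ 2)) by ring.
  by rewrite ex' ey' xy; ring.
have /eqP : s * Y = 0.
  have -> : s * Y = x * (s * Y * x + X * y) - y * (X * x - s * Y * y)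
                + s * Y * (1 - (x ^+ 2 + y ^+ 2)) by ring.
  by rewrite ex' ey' xy; ring.
rewrite mulf_eq0 (negPf s0) /= => /eqP Y0.
have [] := @sqrt33_lin_indep t (3 * (n1 + n2 + n3 + n4)) (n1 - n2 + n3 - n4) t2.
  by rewrite -[RHS]X0 /X; ring.
have [] := @sqrt33_lin_indep t (n2 - n1 + n3 - n4) (n1 + n2 - n3 - n4) t2.
  by rewrite -[RHS]Y0 /Y; ring.
move=> ? ? ? ?; have [-> -> -> ->] // : [/\ n1 = 0, n2 = 0, n3 = 0 & n4 = 0].
by split; lia.
Qed.

(* The images of the first four generators are (1,0), (0,1), (1,0), (1,1); they
   are nonzero, distinct within each rhombus, and do not sum to zero. *)
Definition lattice_color (n : int * int * int * int) : 'Z_2 * 'Z_2 :=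
  ((n.1.1.1 + n.1.2 + n.2)%:~R, (n.1.1.2 + n.2)%:~R).

Fact lattice_color_is_zmod_morphism : zmod_morphism lattice_color.
Proof.
have intrE (i j k : int) : i = j - k -> i%:~R = j%:~R - k%:~R :> 'Z_2.
  by move=> ->; rewrite rmorphB.
by move=> m n; congr (_, _); apply: intrE => /=; ring.
Qed.

HB.instance Definition _ := GRing.isZmodMorphism.Build _ _ lattice_color
  lattice_color_is_zmod_morphism.

Lemma M_set_lattice u v : M_set u v ->
  exists2 n, lattice_vec u n = v & lattice_color n != 0.
Proof.
rewrite /lattice_vec.
case=> [[[[[[->|->]|->]|->]|->]|->]|->].
- by exists (1, 1, 1, 1); rewrite // !mulr1z rotate_relation.
- by exists (1, 0, 0, 0); rewrite // !mulr1z !mulr0z !addr0.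
- by exists (0, 0, 1, 0); rewrite // !mulr1z !mulr0z !addr0 !add0r.
- by exists (0, 1, 0, 0); rewrite // !mulr1z !mulr0z !addr0 !add0r.
- by exists (0, 0, 0, 1); rewrite // !mulr1z !mulr0z !add0r.
- by exists (1, -1, 0, 0); rewrite // !mulrN1z !mulr1z !mulr0z !addr0.
- by exists (0, 0, 1, -1); rewrite // !mulrN1z !mulr1z !mulr0z !add0r.
Qed.

Lemma int_span_lattice u x : int_span (M_set u) x ->
  exists n, lattice_vec u n = x.
Proof.
move=> [k [a [v [Uv ->]]]].
have /choice[m mP] i : exists n, lattice_vec u n = v i.
  by have [n nv _] := M_set_lattice (Uv i); exists n.
exists (\sum_i m i *~ a i); rewrite raddf_sum; apply: eq_bigr => i _.
by rewrite raddfMz /= mP.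
Qed.

(** * Coloring with four colors *)

Lemma colorable_fin (T : finType) (G : graph) (f : vertex G -> T) :
  (forall x y, adj x y -> f x != f y) -> colorable G #|T|.
Proof.
by move=> fP; exists (enum_rank \o f) => x y /fP /eqP + /enum_rank_inj.
Qed.

Lemma vector_graph_colorable4 u :
  unit_vector u -> colorable (vector_graph (M_set u)) 4.
Proof.
move=> hu; have [n nP] := choice (fun x : vertex (vector_graph (M_set u)) =>
  int_span_lattice (svalP x)).
have <- : #|{: 'Z_2 * 'Z_2}| = 4%N by rewrite card_prod !card_ord.
apply: (@colorable_fin _ _ (lattice_color \o n)).
suff H x y : M_set u (sval x - sval y) ->
    lattice_color (n x) != lattice_color (n y).
  by move=> x y [/H //|/H]; rewrite eq_sym.
(* By injectivity, the coordinates of an element x - y of M are n x - n y, so the colors of x and y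
   differ by its nonzero image. *)
move=> /M_set_lattice[m]; rewrite -!nP -raddfB => /(lattice_vec_inj hu) ->.
by rewrite raddfB subr_eq0.
Qed.

(** * The spindle inside the vector graph *)

(** Zero coefficients are allowed and [v], [w] may coincide, so this one form covers all seven
    spindle vertices. *)
Lemma int_span_comb2 U v w (i j : int) :
  U v -> U w -> int_span U (v *~ i + w *~ j).
Proof.
move=> Uv Uw.
exists 2%N, (fun k => if k == 0 then i else j),
  (fun k => if k == 0 then v else w).
split; first by move=> k; case: ifP.
by rewrite big_ord_recl big_ord1.
Qed.

(* The Moser spindle with rhombi 0, a, a + b, b and u, u - a', a + b, u - b'. *)
Lemma vector_graph_colorable_ge4 u k :
  colorable (vector_graph (M_set u)) k -> (4 <= k)%N.
Proof.
set a := rotate (alpha R) u; set b := rotate (beta R) u.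
set a' := rotate (- alpha R) u; set b' := rotate (- beta R) u.
have uE : u = a + b + a' + b' by rewrite rotate_relation.
(* By [uE], the far tip u - a' - b' of the second rhombus is a + b, where it meets the first. *)
have cs : u - a' - (a + b) = b'.
  by apply/eqP; rewrite !subr_eq uE [b' + _]addrC addrAC.
have ds : u - b' - (a + b) = a'.
  by apply/eqP; rewrite !subr_eq uE [a' + _]addrC.
have Mu : M_set u u by do 6!left.
have Ma : M_set u a by do 5!left; right.
have Ma' : M_set u a' by do 4!left; right.
have Mb : M_set u b by do 3!left; right.
have Mb' : M_set u b' by do 2!left; right.
have Mab : M_set u (a - b) by left; right.
have Mab' : M_set u (a' - b') by right.
pose V x := int_span (M_set u) x.
have Vo : V 0 by have := int_span_comb2 0 0 Mu Mu; rewrite !mulr0z addr0.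
have Va : V a by have := int_span_comb2 1 0 Ma Ma; rewrite mulr1z mulr0z addr0.
have Vb : V b by have := int_span_comb2 1 0 Mb Mb; rewrite mulr1z mulr0z addr0.
have Vs : V (a + b) by have := int_span_comb2 1 1 Ma Mb; rewrite !mulr1z.
have Vc : V (u - a').
  by have := int_span_comb2 1 (-1) Mu Ma'; rewrite mulr1z mulrN1z.
have Vd : V (u - b').
  by have := int_span_comb2 1 (-1) Mu Mb'; rewrite mulr1z mulrN1z.
have Vu : V u by have := int_span_comb2 1 0 Mu Mu; rewrite mulr1z mulr0z addr0.
apply: (@spindle_not_3colorable (vector_graph (M_set u)) k
  (exist V 0 Vo) (exist V a Va) (exist V b Vb) (exist V (a + b) Vs)
  (exist V (u - a') Vc) (exist V (u - b') Vd) (exist V u Vu)); rewrite /=.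
- by right; rewrite subr0.
- by right; rewrite subr0.
- by left.
- by left; rewrite addrC addKr.
- by left; rewrite addrK.
- by left; rewrite subKr.
- by left; rewrite subKr.
- by left; rewrite opprB addrC addrA subrK.
- by left; rewrite cs.
- by left; rewrite ds.
- by left; rewrite subr0.
Qed.

End Plane.

Theorem theorem2 (R : realType) (u : 'cV[R]_2) (hu : unit_vector u) :
  has_chromatic_number (vector_graph (M_set u)) 4.
Proof.
split=> // [|j _]; first exact: vector_graph_colorable4.
exact: vector_graph_colorable_ge4.
Qed.
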